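(* There exists a non-computable oracle $X$ which is low for speed.
   Context: Oracles are languages $X\subseteq\{0,1\}^*$; via the identification of the $(n+1)$-th string in length-lexicographic order with $n$, they are also viewed as subsets of $\mathbb{N}$ and as infinite binary sequences in $\{0,1\}^\omega$. Oracle computations are measured in the usual complexity-theoretic model: the machine has a query tape, and once a string $x$ is written on it, the answer to ''is $x\in X$?'' is obtained in time $O(1)$. An oracle $X$ is \emph{low for speed} if for every computable (decidable) language $L$: whenever some oracle Turing machine $M$ with oracle $X$ decides $L$ within time bound $f$ (i.e. $time(M^X,x)\le f(x)$ for all inputs $x$), there exist a Turing machine $M'$ without oracle and a polynomial $p$ such that $M'$ decides $L$ within time bound $p\circ f$. *)

(* Defs.v *)
From HB Require Import structures.
From mathcomp Require Import all_boot all_order all_algebra.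
Set Implicit Arguments. Unset Strict Implicit. Unset Printing Implicit Defensive.
Import GRing.Theory.

(* Tape alphabet with m extra symbols: None = blank, Some (inl b) = bit b,
   Some (inr j) = auxiliary symbol j. *)
Definition Sym (m : nat) := option (bool + 'I_m).

Inductive move := MLeft | MStay | MRight.

(* A multi-tape (oracle) Turing machine with k.+2 one-way infinite tapes:
   tape ord0 is the input tape, tape ord_max is the query tape.
   The state set is an arbitrary finite type.  [tm_query = Some (qq, qy, qn)]
   gives the query state and the two answer states; [tm_query = None] means
   the machine has no oracle access at all. *)
Record OTM := {
  tm_k : nat;
  tm_m : nat;
  tm_Q : finType;
  tm_start : tm_Q;
  tm_acc : tm_Q;
  tm_rej : tm_Q;
  tm_query : option (tm_Q * tm_Q * tm_Q);
  tm_delta : tm_Q -> ('I_tm_k.+2 -> Sym tm_m) ->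
             tm_Q * ('I_tm_k.+2 -> Sym tm_m) * ('I_tm_k.+2 -> move)
}.

Definition oracle_free (M : OTM) : Prop := tm_query M = None.

(* Configurations: state, tape contents (cells beyond the list are blank),
   head positions. *)
Record config (M : OTM) := Config {
  c_state : tm_Q M;
  c_tapes : 'I_(tm_k M).+2 -> seq (Sym (tm_m M));
  c_heads : 'I_(tm_k M).+2 -> nat
}.

(* The string currently on the query tape: the maximal block of bits
   starting at the leftmost cell. *)
Fixpoint bits_prefix (m : nat) (s : seq (Sym m)) : seq bool :=
  match s with
  | Some (inl b) :: s' => b :: bits_prefix s'
  | _ => [::]
  end.

Definition halted (M : OTM) (c : config M) : bool :=
  (c_state c == tm_acc M) || (c_state c == tm_rej M).

Definition move_head (mv : move) (p : nat) : nat :=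
  match mv with MLeft => p.-1 | MStay => p | MRight => p.+1 end.

Definition delta_step (M : OTM) (c : config M) : config M :=
  let: (q', w, mv) := tm_delta (c_state c)
                        (fun i => nth None (c_tapes c i) (c_heads c i)) in
  Config q' (fun i => set_nth None (c_tapes c i) (c_heads c i) (w i))
            (fun i => move_head (mv i) (c_heads c i)).

Definition step (M : OTM) (X : pred (seq bool)) (c : config M) : config M :=
  if halted c then c else
  match tm_query M with
  | Some (qq, qy, qn) =>
      if c_state c == qq then
        Config (if X (bits_prefix (c_tapes c ord_max)) then qy else qn)
               (c_tapes c) (c_heads c)
      else delta_step c
  | None => delta_step c
  end.

Definition init (M : OTM) (x : seq bool) : config M :=
  Config (tm_start M)
         (fun i => if i == ord0 then [seq Some (inl b) | b <- x] else [::])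
         (fun _ => 0).

Definition run (M : OTM) (X : pred (seq bool)) (x : seq bool) (t : nat)
  : config M := iter t (step X) (init M x).

Definition decides_within (M : OTM) (X : pred (seq bool))
    (L : pred (seq bool)) (f : seq bool -> nat) : Prop :=
  forall x, exists t, t <= f x /\ halted (run M X x t) /\
    ((c_state (run M X x t) == tm_acc M) = L x).

(* The empty oracle; irrelevant for oracle-free machines. *)
Definition no_oracle : pred (seq bool) := fun _ => false.

Definition computable (L : pred (seq bool)) : Prop :=
  exists (M : OTM) (f : seq bool -> nat),
    oracle_free M /\ decides_within M no_oracle L f.

Definition low_for_speed (X : pred (seq bool)) : Prop :=
  forall (L : pred (seq bool)), computable L ->
  forall (M : OTM) (f : seq bool -> nat), decides_within M X L f ->
  exists (M' : OTM) (p : {poly nat}),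
    oracle_free M' /\ decides_within M' no_oracle L (fun x => (p.[f x])%R).

(* Main.v *)
(* The oracle answers a query according to the length of the string only, and
   it may say yes only on lengths p with p + 1 a power of 2.  In time t a
   machine sees O(log t) such lengths, so only polynomially many oracles are
   possible: an oracle-free machine can try them all, with a growing time
   bound, and output the first answer it finds.  This answer is right as soon
   as no oracle of this shape leads to a wrong one.  A generic oracle ensures
   it: for each pair of a machine M and a decider N, a finite part of the
   oracle either makes M halt with an answer different from that of N, or rules
   this out for every sparse extension.  In the second case the search, with
   that finite part hard-wired, is the required machine.  Genericity also makes
   the oracle differ from every computable language. *)
Require Import Defs.
From HB Require Import structures.
From mathcomp Require Import all_boot all_order all_algebra zify.
From Stdlib Require Import ClassicalEpsilon FunctionalExtensionality.
Set Implicit Arguments. Unset Strict Implicit. Unset Printing Implicit Defensive.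

(** * Runs of oracle machines *)

Definition is_bit m (y : Sym m) : bool := if y is Some (inl _) then true else false.

Lemma is_bit_bits_prefix m (s : seq (Sym m)) j :
  j < size (bits_prefix s) -> is_bit (nth None s j).
Proof. by elim: s j => [|[[b|x]|] s IH] [|j] //= /IH. Qed.

Lemma nonbit_bits_prefix m (s : seq (Sym m)) :
  ~~ is_bit (nth None s (size (bits_prefix s))).
Proof. by elim: s => [|[[b|x]|] s IH]. Qed.

Lemma size_bits_prefix_le m (s : seq (Sym m)) p :
  ~~ is_bit (nth None s p) -> size (bits_prefix s) <= p.
Proof. by rewrite leqNgt; apply: contra; apply: is_bit_bits_prefix. Qed.

Section Runs.
Variables (M : OTM).
Implicit Types (X Y : pred (seq bool)) (x : seq bool) (c : config M).

Lemma runS X x t : run M X x t.+1 = step X (run M X x t).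
Proof. by []. Qed.

Lemma step_halted X c : halted c -> step X c = c.
Proof. by rewrite /step => ->. Qed.

Lemma run_halted X x s t : halted (run M X x s) -> s <= t ->
  run M X x t = run M X x s.
Proof.
move=> hs /subnKC <-; elim: (t - s) => [|d IH]; first by rewrite addn0.
by rewrite addnS runS IH step_halted.
Qed.

Lemma halted_runs_agree X x s t : halted (run M X x s) -> halted (run M X x t) ->
  run M X x s = run M X x t.
Proof.
move=> hs ht; case: (leqP s t) => [le|/ltnW le]; last exact: run_halted.
by rewrite -(run_halted hs le).
Qed.

Lemma decides_within_halted X L f x t : decides_within M X L f ->
  halted (run M X x t) -> (c_state (run M X x t) == tm_acc M) = L x.
Proof.
by move=> /(_ x) [s [_ [hs <-]]] ht; rewrite (halted_runs_agree ht hs).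
Qed.

Lemma nth_delta_step c i p :
  nth None (c_tapes (delta_step c) i) p =
  if p == c_heads c i then
    (tm_delta (c_state c) (fun i => nth None (c_tapes c i) (c_heads c i))).1.2 i
  else nth None (c_tapes c i) p.
Proof.
rewrite /delta_step; case: (tm_delta _ _) => [[q w] mv] /=.
by rewrite nth_set_nth /=.
Qed.

Lemma heads_delta_step c i :
  c_heads (delta_step c) i <= (c_heads c i).+1.
Proof.
rewrite /delta_step; case: (tm_delta _ _) => [[q w] mv] /=.
by case: (mv i) => /=; lia.
Qed.

(** A head starts at the left end and advances at most one cell per step, so no write of the first
    [t] steps reaches position [t]. *)
Lemma run_bounds X x t i :
  c_heads (run M X x t) i <= t /\
  forall p, t <= p -> nth None (c_tapes (run M X x t) i) p =
    nth None (c_tapes (init M x) i) p.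
Proof.
elim: t => [|t [IHh IHt]] //; rewrite runS /step.
have del : c_heads (delta_step (run M X x t)) i <= t.+1 /\
  forall p, t.+1 <= p -> nth None (c_tapes (delta_step (run M X x t)) i) p =
    nth None (c_tapes (init M x) i) p.
  split=> [|p lp]; first exact: leq_trans (heads_delta_step _ _) _.
  rewrite nth_delta_step IHt 1?ltnW //.
  by case: eqP => // e; move: lp; rewrite e ltnNge IHh.
have id : c_heads (run M X x t) i <= t.+1 /\
  forall p, t.+1 <= p -> nth None (c_tapes (run M X x t) i) p =
    nth None (c_tapes (init M x) i) p.
  by split=> [|p /ltnW /IHt]//; apply: leqW.
by case: ifP => // _; case: (tm_query M) => [[[qq qy] qn]|] //; case: ifP.
Qed.

Lemma query_length X x t :
  size (bits_prefix (c_tapes (run M X x t) ord_max)) <= t.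
Proof.
apply: size_bits_prefix_le.
have [_ ->] := run_bounds X x t ord_max; last exact: leqnn.
by rewrite /= nth_nil.
Qed.

(* The query tape is blank at the start, so in [t] steps only strings shorter
   than [t] can be queried. *)
Lemma run_local X Y x t : (forall w, size w < t -> X w = Y w) ->
  run M X x t = run M Y x t.
Proof.
elim: t => [|t IH] XY //; rewrite !runS -IH => [|w lw]; last exact/XY/ltnW.
rewrite /step; case: ifP => // _; case: (tm_query M) => [[[qq qy] qn]|] //.
by case: ifP => // _; rewrite XY // ltnS query_length.
Qed.

End Runs.

(** * The search machine *)

Definition update T (f : nat -> T) (p : nat) (v : T) : nat -> T :=
  fun q => if q == p then v else f q.

(* A work symbol remembers the input bit (or blank) that the cell held
   originally, so that the simulation can be undone without copying the input. *)
Definition Cell m := (option bool * Sym m)%type.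

(* Fields: leftmost cell, coordinate of the guess, value, return mark. *)
Definition Aux := (bool * bool * bool * bool)%type.

(** * Machines with structured cells, compiled to oracle-free machines *)

Section TrackMachine.
Variables (k m : nat) (S : finType) (start acc rej : S).

Record effect := Effect {
  e_state : S;
  e_write : 'I_k.+2 -> Cell m;
  e_clock : option Aux;
  e_guess : option Aux;
  e_move : 'I_k.+2 -> move;
  e_cmove : move;
  e_gmove : move
}.

Variable delta : S -> ('I_k.+2 -> Cell m) -> option Aux -> option Aux -> effect.

(** Tapes are total functions rather than lists, so that a tape restored cell by cell equals the
    original, with no trailing blanks to compare. *)
Record tconfig := TConfig {
  t_state : S;
  t_tapes : 'I_k.+2 -> nat -> Cell m;
  t_heads : 'I_k.+2 -> nat;
  t_clock : nat -> option Aux;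
  t_chead : nat;
  t_guess : nat -> option Aux;
  t_ghead : nat
}.

Definition tstep (c : tconfig) : tconfig :=
  if (t_state c == acc) || (t_state c == rej) then c else
  let e := delta (t_state c) (fun i => t_tapes c i (t_heads c i))
             (t_clock c (t_chead c)) (t_guess c (t_ghead c)) in
  TConfig (e_state e)
    (fun i => update (t_tapes c i) (t_heads c i) (e_write e i))
    (fun i => move_head (e_move e i) (t_heads c i))
    (update (t_clock c) (t_chead c) (e_clock e))
    (move_head (e_cmove e) (t_chead c))
    (update (t_guess c) (t_ghead c) (e_guess e))
    (move_head (e_gmove e) (t_ghead c)).

Definition input_cell (b : option bool) : Cell m := (b, omap inl b).

Definition tinit (x : seq bool) : tconfig :=
  TConfig start
    (fun i p => input_cell (if i == ord0 then nth None (map Some x) p else None))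
    (fun _ => 0) (fun _ => None) 0 (fun _ => None) 0.

Let E : finType := (Cell m + Aux)%type.

(** Cells are always written as auxiliary symbols; raw bits and blanks decode as untouched input
    cells, so the input needs no preparatory pass. *)
Definition enc_cell (a : Cell m) : Sym #|E| := Some (inr (enum_rank (inl a : E))).
Definition dec_cell (y : Sym #|E|) : Cell m :=
  match y with
  | None => input_cell None
  | Some (inl b) => input_cell (Some b)
  | Some (inr j) => if enum_val j is inl a then a else input_cell None
  end.
Definition enc_aux (a : option Aux) : Sym #|E| :=
  omap (fun a => inr (enum_rank (inr a : E))) a.
Definition dec_aux (y : Sym #|E|) : option Aux :=
  if y is Some (inr j) then (if enum_val j is inr a then Some a else None) else None.

Lemma enc_cellK a : dec_cell (enc_cell a) = a.
Proof. by rewrite /= enum_rankK. Qed.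

Lemma enc_auxK a : dec_aux (enc_aux a) = a.
Proof. by case: a => //= a; rewrite enum_rankK. Qed.

Definition work_tape (i : 'I_k.+2) : 'I_k.+4 := widen_ord (ltnW (leqnSn k.+3)) i.
Definition clock_tape : 'I_k.+4 := Ordinal (leqnSn k.+3).
Definition guess_tape : 'I_k.+4 := ord_max.

Definition on_tapes T (f : 'I_k.+2 -> T) (c g : T) (i : 'I_k.+4) : T :=
  if insub (val i) is Some j then f j else if i == clock_tape then c else g.

Lemma on_work_tape T f (c g : T) i : on_tapes f c g (work_tape i) = f i.
Proof. by rewrite /on_tapes /= valK. Qed.

Lemma on_clock_tape T f (c g : T) : on_tapes f c g clock_tape = c.
Proof. by rewrite /on_tapes insubF ?eqxx // ltnn. Qed.

Lemma on_guess_tape T f (c g : T) : on_tapes f c g guess_tape = g.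
Proof.
rewrite /on_tapes insubF; last by rewrite ltnNge leqnSn.
by rewrite -val_eqE /= eqn_leq ltnn.
Qed.

Definition track_machine : OTM := {|
  tm_k := k.+2; tm_m := #|E|; tm_Q := S;
  tm_start := start; tm_acc := acc; tm_rej := rej; tm_query := None;
  tm_delta := fun s f =>
    let e := delta s (fun i => dec_cell (f (work_tape i)))
               (dec_aux (f clock_tape)) (dec_aux (f guess_tape)) in
    (e_state e,
     on_tapes (fun i => enc_cell (e_write e i)) (enc_aux (e_clock e)) (enc_aux (e_guess e)),
     on_tapes (e_move e) (e_cmove e) (e_gmove e)) |}.

Definition tracks (c : config track_machine) : tconfig :=
  @TConfig (c_state c : S)
    (fun i p => dec_cell (nth None (c_tapes c (work_tape i)) p))
    (fun i => c_heads c (work_tape i))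
    (fun p => dec_aux (nth None (c_tapes c clock_tape) p)) (c_heads c clock_tape)
    (fun p => dec_aux (nth None (c_tapes c guess_tape) p)) (c_heads c guess_tape).

Lemma tracks_step c : tracks (step no_oracle c) = tstep (tracks c).
Proof.
rewrite /step /tstep /halted /=; case: ifP => // _.
rewrite /tracks /delta_step /= !on_clock_tape !on_guess_tape; congr TConfig.
- apply: functional_extensionality => i; apply: functional_extensionality => p.
  rewrite nth_set_nth /= /update on_work_tape; case: eqP => // _.
  exact: enc_cellK.
- by apply: functional_extensionality => i; rewrite on_work_tape.
- apply: functional_extensionality => p; rewrite nth_set_nth /= /update.
  by case: eqP => // _; exact: enc_auxK.
- apply: functional_extensionality => p; rewrite nth_set_nth /= /update.
  by case: eqP => // _; exact: enc_auxK.
Qed.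

Lemma tracks_init x : tracks (init track_machine x) = tinit x.
Proof.
congr TConfig.
- apply: functional_extensionality => i; apply: functional_extensionality => p.
  rewrite /= (_ : (work_tape i == ord0) = (i == ord0)) //.
  case: ifP => _; last by rewrite nth_nil.
  by elim: x p => [|b x IH] [|p] //=; apply: IH.
- by apply: functional_extensionality => p; rewrite /= nth_nil.
- by apply: functional_extensionality => p; rewrite /= nth_nil.
Qed.

Lemma tracks_run x t : tracks (run track_machine no_oracle x t) = iter t tstep (tinit x).
Proof. by elim: t => [|t IH] /=; rewrite ?tracks_init // tracks_step IH. Qed.

End TrackMachine.

(** * States and transitions of the search *)

Section Search.
Variables (M : OTM) (l : nat) (h : nat -> bool).

(** [Sim] simulates [M], the next four states answer one query, [Rewind] and [Sweep] lead to the
    next attempt. The boolean of [ReturnLeft] and [ReturnRight] is the answer, that of [Rewind]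
    tells whether a sweep is still due, that of [Sweep] is the carry. *)
Inductive state :=
| Setup
| Sim of tm_Q M
| SeekLeft
| Scan of 'I_l.+1
| ReturnLeft of bool
| ReturnRight of bool
| Rewind of bool
| Sweep of bool
| Final of bool.

Definition state_code (s : state) :
  (tm_Q M + 'I_l.+1 + (bool + bool) + (bool + bool) + (bool + bool))%type :=
  match s with
  | Setup => inr (inr true)
  | SeekLeft => inr (inr false)
  | Sim q => inl (inl (inl (inl q)))
  | Scan n => inl (inl (inl (inr n)))
  | ReturnLeft b => inl (inl (inr (inl b)))
  | ReturnRight b => inl (inl (inr (inr b)))
  | Rewind b => inl (inr (inl b))
  | Sweep b => inl (inr (inr b))
  | Final b => inr (inl b)
  end.

Definition state_decode s : state :=
  match s with
  | inr (inr b) => if b then Setup else SeekLeft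
  | inl (inl (inl (inl q))) => Sim q
  | inl (inl (inl (inr n))) => Scan n
  | inl (inl (inr (inl b))) => ReturnLeft b
  | inl (inl (inr (inr b))) => ReturnRight b
  | inl (inr (inl b)) => Rewind b
  | inl (inr (inr b)) => Sweep b
  | inr (inl b) => Final b
  end.

Lemma state_codeK : cancel state_code state_decode.
Proof. by case. Qed.

HB.instance Definition _ := Equality.copy state (can_type state_codeK).
HB.instance Definition _ := Choice.copy state (can_type state_codeK).
HB.instance Definition _ := Countable.copy state (can_type state_codeK).
HB.instance Definition _ := Finite.copy state (can_type state_codeK).

Definition leftmost (a : option Aux) : bool := if a is Some (b, _, _, _) then b else false.
Definition guess_bit (a : option Aux) : bool :=
  if a is Some (_, d, b, _) then d && b else false.
Definition is_marked (a : option Aux) : bool := if a is Some (_, _, _, r) then r else false.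
Definition set_mark (r : bool) (a : option Aux) : option Aux :=
  omap (fun a : Aux => let: (f, d, b, _) := a in (f, d, b, r)) a.
Definition add_carry (cy : bool) (a : option Aux) : option Aux :=
  omap (fun a : Aux => let: (f, d, b, r) := a in (f, d, if d then b (+) cy else b, r)) a.
Definition next_carry (cy : bool) (a : option Aux) : bool :=
  if a is Some (_, true, b, _) then cy && b else cy.

Definition is_query (q : tm_Q M) : bool :=
  if tm_query M is Some (qq, _, _) then q == qq else false.
Definition answer_state (r : bool) : tm_Q M :=
  if tm_query M is Some (_, qy, qn) then (if r then qy else qn) else tm_start M.

(** The finite control counts positions only up to [l]; once the counter is saturated, the answer
    comes from the guess tape. *)
Definition next_scan (n : 'I_l.+1) : 'I_l.+1 := inord (minn n.+1 l).
Definition answer (n : nat) (a : option Aux) : bool := if n < l then h n else guess_bit a.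

Let k := tm_k M.
Let m := tm_m M.

Definition clean (f : 'I_k.+2 -> Cell m) : 'I_k.+2 -> Cell m :=
  fun i => input_cell m (f i).1.

Definition query_move (mv : move) (i : 'I_k.+2) : move :=
  if i == ord_max then mv else MStay.

(* The guess head moves along with the query head.  A query is answered by
   going to the first non-bit of the query tape: its position is the length of
   the query, and the guess head then scans the answer. *)
Definition search_delta (s : state) (f : 'I_k.+2 -> Cell m) (c g : option Aux) :
    effect k m state :=
  let go s' := Effect s' f c g (fun _ => MStay) MStay MStay in
  let go_query s' mv := Effect s' f c g (query_move mv) MStay mv in
  match s with
  | Setup => Effect (Sim (tm_start M)) f (Some (true, false, false, false))
               (Some (true, true, true, false)) (fun _ => MStay) MStay MStay
  | Sim q =>
    if q == tm_acc M then go (Final true)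
    else if q == tm_rej M then go (Final false)
    else if c is None then go (Rewind true)
    else if is_query q then
      Effect SeekLeft f c (set_mark true g) (fun _ => MStay) MStay MStay
    else let: (q', w, mv) := tm_delta q (fun i => (f i).2) in
      Effect (Sim q') (fun i => ((f i).1, w i)) c g mv MRight (mv ord_max)
  | SeekLeft => if leftmost g then go (Scan ord0) else go_query SeekLeft MLeft
  | Scan n => if is_bit (f ord_max).2 then go_query (Scan (next_scan n)) MRight
              else go (ReturnLeft (answer n g))
  | ReturnLeft r => if leftmost g then go (ReturnRight r) else go_query (ReturnLeft r) MLeft
  | ReturnRight r =>
    if is_marked g then
      Effect (Sim (answer_state r)) f c (set_mark false g) (fun _ => MStay) MRight MStay
    else go_query (ReturnRight r) MRight
  | Rewind b =>
    if leftmost c then go (if b then Sweep true else Sim (tm_start M))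
    else Effect (Rewind b) f c g (fun _ => MLeft) MLeft MLeft
  | Sweep cy =>
    if c is Some _ then
      Effect (Sweep (next_carry cy g)) (clean f) c (add_carry cy g)
        (fun _ => MRight) MRight MRight
    else Effect (Rewind false) f (Some (false, false, false, false))
           (Some (false, cy, cy, false)) (fun _ => MStay) MStay MStay
  | Final b => go (Final b)
  end.

Definition search_machine : OTM :=
  track_machine (Setup : state) (Final true : state) (Final false : state) search_delta.

End Search.

Arguments Setup {M l}.
Arguments Sim {M l} _.
Arguments SeekLeft {M l}.
Arguments Scan {M l} _.
Arguments ReturnLeft {M l} _.
Arguments ReturnRight {M l} _.
Arguments Rewind {M l} _.
Arguments Sweep {M l} _.
Arguments Final {M l} _.

(** * Sparse oracles and binary counters *)

Definition pow2 (n : nat) : bool := n == 2 ^ up_log 2 n.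

Definition sparse (a : nat -> bool) : Prop := forall p, a p -> pow2 p.+1.

(* The [i]-th guess reads the binary expansion of [i] off at the positions
   [2 ^ j - 1]. *)
Definition guess (i p : nat) : bool := pow2 p.+1 && odd (i %/ p.+1).

Lemma pow2_exp j : pow2 (2 ^ j).
Proof. by rewrite /pow2 up_expnK. Qed.

Lemma pow2P n : reflect (exists j, n = 2 ^ j) (pow2 n).
Proof.
by apply: (iffP eqP) => [->|[j ->]]; [exists (up_log 2 n) | rewrite up_expnK].
Qed.

Lemma up_log_succ p : up_log 2 p.+2 = up_log 2 p.+1 + pow2 p.+1.
Proof.
have lo := @up_logP 2 p.+1 isT.
case: (boolP (pow2 p.+1)) => [/eqP e|ne] /=.
  rewrite addn1; apply: up_log_eq => //; rewrite expnS -e; lia.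
have lt : p.+1 < 2 ^ up_log 2 p.+1 by rewrite ltn_neqAle lo andbT.
by apply/eqP; rewrite addn0 eqn_leq up_log_min ?leq_up_log.
Qed.

(** The carry that reaches position [p] when [i] is increased by one: every digit stored before [p]
    is 1. *)
Definition carry (i p : nat) : bool :=
  all (fun q => pow2 q.+1 ==> odd (i %/ q.+1)) (iota 0 p).

Lemma carryS i p : carry i p.+1 = carry i p && (pow2 p.+1 ==> odd (i %/ p.+1)).
Proof.
have -> : carry i p.+1 = all (fun q => pow2 q.+1 ==> odd (i %/ q.+1)) (iota 0 (p + 1)).
  by rewrite addn1.
by rewrite iotaD all_cat /= andbT.
Qed.

(** Once [2 ^ j] divides [n.+1], the quotient is one more than [n %/ 2 ^ j], so it is even exactly
    when the latter is odd. *)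
Lemma dvdn_expS j n : (2 ^ j.+1 %| n.+1) = (2 ^ j %| n.+1) && odd (n %/ 2 ^ j).
Proof.
rewrite expnSr; case: (boolP (2 ^ j %| n.+1)) => [dv|ndv] /=; last first.
  by apply: contraNF ndv; exact: dvdn_trans (dvdn_mulr _ (dvdnn _)).
have := divnS n (expn_gt0 2 j : 0 < 2 ^ j); rewrite dv add1n => e.
rewrite -[odd _]negbK -oddS -e -dvdn2 -[in LHS](divnK dv) mulnC.
by rewrite dvdn_pmul2r ?expn_gt0.
Qed.

(** [up_log 2 p.+1] counts the digits stored before [p]; the lowest digits of [i] are all 1 exactly
    when the corresponding power of two divides [i.+1]. *)
Lemma carryE i p : carry i p = (2 ^ up_log 2 p.+1 %| i.+1).
Proof.
elim: p => [|p IH]; first by rewrite up_log1 dvd1n.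
rewrite carryS IH up_log_succ; case: (boolP (pow2 p.+1)) => [/eqP e|_] /=.
  by rewrite addn1 dvdn_expS -e.
by rewrite andbT addn0.
Qed.

Lemma odd_carry i p : pow2 p.+1 ->
  odd (i.+1 %/ p.+1) = odd (i %/ p.+1) (+) carry i p.
Proof.
by move=> /eqP e; rewrite divnS // oddD oddb carryE -e addbC.
Qed.

(** All digits of [i] are stored on the first [i] cells, and a carry leaves them exactly when cell
    [i] has to hold a new digit. Hence the sweep can fill that cell from the carry alone. *)
Lemma carry_end i : carry i i = pow2 i.+1.
Proof.
rewrite carryE; apply/idP/eqP => [dv|<-]; last exact: dvdnn.
by apply/eqP; rewrite eqn_leq up_logP //= dvdn_leq.
Qed.

Lemma guess_end i : guess i.+1 i = pow2 i.+1.
Proof. by rewrite /guess divnn andbT. Qed.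

Lemma guess_sparse i : sparse (guess i).
Proof. by move=> p /andP[]. Qed.

(* Given [a] and [t], pick [i] whose binary digits of weight at most [t] agree
   with [a], and with a higher digit set to make the attempt long enough. *)
Lemma agreeing_guess (a : nat -> bool) t : sparse a ->
  exists i, [/\ t < i, i <= 4 * t.+1 & forall p, p <= t -> guess i p = a p].
Proof.
move=> sa.
have key j : exists2 i, 2 ^ j <= i < 2 ^ j.+1 &
    forall e, e < j -> odd (i %/ 2 ^ e) = a (2 ^ e).-1.
  elim: j => [|j [i bi oi]]; first by exists 1.
  pose d := a (2 ^ j).-1.
  have bi' : i - 2 ^ j < 2 ^ j by rewrite expnS in bi; lia.
  (* The leading digit [2 ^ j] of [i] is replaced by the wanted digit [d], and a new leading digit
     is put above it. *)
  exists (2 ^ j.+1 + d * 2 ^ j + (i - 2 ^ j)).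
    by rewrite !expnS in bi bi' *; case: (d); lia.
  move=> e; rewrite ltnS leq_eqVlt => /orP[/eqP -> {e}|lt].
    rewrite expnS -mulnDl divnMDl ?expn_gt0 // divn_small // addn0 oddD /=.
    by rewrite oddb.
  rewrite -(oi e lt).
  have ej : 2 ^ j = 2 ^ (j - e).-1 * 2 * 2 ^ e.
    by rewrite -expnSr prednK ?subn_gt0 // -expnD subnK // ltnW.
  have -> : 2 ^ j.+1 + d * 2 ^ j + (i - 2 ^ j) =
      (1 + d) * (2 ^ (j - e).-1 * 2) * 2 ^ e + i.
    by rewrite -[in RHS]mulnA -ej expnS; rewrite expnS in bi; case: (d); lia.
  by rewrite divnMDl ?expn_gt0 // oddD !oddM !andbF.
(* The leading weight is at least [t.+2], hence above every weight [p.+1] with [p <= t]; minimality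
   of [up_log] gives the upper bound on [i]. *)
have [i bi oi] := key (up_log 2 t.+2).
exists i; split.
- by have := @up_logP 2 t.+2 isT; lia.
- have /andP[] := @up_log_bounds 2 t.+2 isT isT.
  case: (up_log 2 t.+2) bi {oi} => [|j] /=; last by rewrite !expnS; lia.
  by rewrite expn0 expn1; lia.
move=> p lp; rewrite /guess; case: (boolP (pow2 p.+1)) => [|np] /=.
  case/pow2P=> e ep; rewrite ep oi -?ep //.
  by rewrite -(@ltn_exp2l 2) // -ep; have := @up_logP 2 t.+2 isT; lia.
by apply/esym/negbTE; apply: contra np; apply: sa.
Qed.

(** * Phases of the search *)

Lemma update_id T (f : nat -> T) p : update f p (f p) = f.
Proof. by apply: functional_extensionality => q; rewrite /update; case: eqP => [->|]. Qed.

Lemma update_eq T (f : nat -> T) p v : f p = v -> update f p v = f.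
Proof. by move=> <-; apply: update_id. Qed.

Lemma update_update T (f : nat -> T) p v w : update (update f p v) p w = update f p w.
Proof. by apply: functional_extensionality => q; rewrite /update; case: eqP. Qed.

Lemma update_at T (f : nat -> T) p v : update f p v p = v.
Proof. by rewrite /update eqxx. Qed.

Section Phases.
Variables (M : OTM) (l : nat) (h : nat -> bool).
Let k := tm_k M.
Let m := tm_m M.
Let st := state M l.
Let conf := tconfig k m st.

Definition sstep : conf -> conf := tstep (Final true) (Final false) (search_delta h).

Definition reach (n : nat) (c c' : conf) : Prop := exists2 d, d <= n & iter d sstep c = c'.

Lemma reach_refl c : reach 0 c c.
Proof. by exists 0. Qed.

Lemma reach_trans n1 n2 c1 c2 c3 : reach n1 c1 c2 -> reach n2 c2 c3 -> reach (n1 + n2) c1 c3.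
Proof.
move=> [d1 l1 <-] [d2 l2 <-]; exists (d2 + d1); first by rewrite addnC leq_add.
by rewrite iterD.
Qed.

Lemma reach_weaken n1 n2 c c' : n1 <= n2 -> reach n1 c c' -> reach n2 c c'.
Proof. by move=> le [d ld e]; exists d => //; apply: leq_trans le. Qed.

Lemma reach1 c c' : sstep c = c' -> reach 1 c c'.
Proof. by exists 1. Qed.

Lemma reachS n c c1 c' : sstep c = c1 -> reach n c1 c' -> reach n.+1 c c'.
Proof. by move=> /reach1 r1 r2; rewrite -add1n; apply: reach_trans r1 r2. Qed.

Definition is_final (s : st) : bool := if s is Final _ then true else false.

Implicit Types (s : st) (T : 'I_k.+2 -> nat -> Cell m) (H : 'I_k.+2 -> nat)
  (C G : nat -> option Aux).

Lemma sstepE s T H C hc G hg : ~~ is_final s ->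
  sstep (TConfig s T H C hc G hg) =
  let e := search_delta h s (fun i => T i (H i)) (C hc) (G hg) in
  TConfig (e_state e)
    (fun i => update (T i) (H i) (e_write e i))
    (fun i => move_head (e_move e i) (H i))
    (update C hc (e_clock e)) (move_head (e_cmove e) hc)
    (update G hg (e_guess e)) (move_head (e_gmove e) hg).
Proof. by rewrite /sstep /tstep; case: s. Qed.

Lemma sstep_go s s' T H C hc G hg : ~~ is_final s ->
  search_delta h s (fun i => T i (H i)) (C hc) (G hg) =
    Effect s' (fun i => T i (H i)) (C hc) (G hg) (fun _ => MStay) MStay MStay ->
  sstep (TConfig s T H C hc G hg) = TConfig s' T H C hc G hg.
Proof.
move=> nf e; rewrite sstepE // e /= !update_id; congr TConfig.
by apply: functional_extensionality => i; rewrite update_id.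
Qed.

Definition with_query_head H p : 'I_k.+2 -> nat := fun i => if i == ord_max then p else H i.

Lemma with_query_head_id H : with_query_head H (H ord_max) = H.
Proof.
by apply: functional_extensionality => i; rewrite /with_query_head; case: eqP => [->|].
Qed.

Lemma sstep_go_query s s' mv T H C hc G p : ~~ is_final s ->
  let f := fun i => T i (with_query_head H p i) in
  search_delta h s f (C hc) (G p) = Effect s' f (C hc) (G p) (query_move mv) MStay mv ->
  sstep (TConfig s T (with_query_head H p) C hc G p) =
  TConfig s' T (with_query_head H (move_head mv p)) C hc G (move_head mv p).
Proof.
move=> nf f e; rewrite sstepE // e /= !update_id; congr TConfig.
  by apply: functional_extensionality => i; rewrite update_id.
apply: functional_extensionality => i.
by rewrite /query_move /with_query_head; case: eqP.
Qed.

Lemma seek_left T H C hc G p : (forall q, q <= p -> leftmost (G q) = (q == 0)) ->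
  reach p.+1 (TConfig SeekLeft T (with_query_head H p) C hc G p)
    (TConfig (Scan ord0) T (with_query_head H 0) C hc G 0).
Proof.
elim: p => [|p IH] lG.
  by apply: reach1; apply: sstep_go => //=; rewrite lG.
apply: reachS (IH _) => [|q lq]; last exact/lG/leqW.
by rewrite (@sstep_go_query _ SeekLeft MLeft) //=; rewrite lG.
Qed.

Lemma return_left r T H C hc G p : (forall q, q <= p -> leftmost (G q) = (q == 0)) ->
  reach p.+1 (TConfig (ReturnLeft r) T (with_query_head H p) C hc G p)
    (TConfig (ReturnRight r) T (with_query_head H 0) C hc G 0).
Proof.
elim: p => [|p IH] lG.
  by apply: reach1; apply: sstep_go => //=; rewrite lG.
apply: reachS (IH _) => [|q lq]; last exact/lG/leqW.
by rewrite (@sstep_go_query _ (ReturnLeft r) MLeft) //=; rewrite lG.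
Qed.

Lemma answer_saturated n a : answer l h (minn n l) a = answer l h n a.
Proof.
by rewrite /answer; case: (ltnP n l) => [-> //|_]; rewrite ltnn.
Qed.

Lemma scan_from T H C hc G d p :
  (forall q, q < d + p -> is_bit (T ord_max q).2) -> ~~ is_bit (T ord_max (d + p)).2 ->
  reach d.+1 (TConfig (Scan (inord (minn p l))) T (with_query_head H p) C hc G p)
    (TConfig (ReturnLeft (answer l h (d + p) (G (d + p)))) T (with_query_head H (d + p))
       C hc G (d + p)).
Proof.
have lt q : minn q l < l.+1 by rewrite ltnS geq_minr.
elim: d p => [|d IH] p bits nonbit.
  apply: reach1; apply: sstep_go => //=; rewrite /with_query_head eqxx.
  by rewrite (negbTE nonbit) inordK // answer_saturated.
rewrite addSnnS in bits nonbit *; apply: reachS (IH _ bits nonbit).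
rewrite (@sstep_go_query _ (Scan (inord (minn p.+1 l))) MRight) //=.
rewrite {1}/with_query_head eqxx bits ?addnS ?ltnS ?leq_addl //.
congr (Effect (Scan _) _ _ _ _ _ _); rewrite /next_scan inordK //.
by congr inord; lia.
Qed.

Lemma scan T H C hc G n :
  (forall p, p < n -> is_bit (T ord_max p).2) -> ~~ is_bit (T ord_max n).2 ->
  reach n.+1 (TConfig (Scan ord0) T (with_query_head H 0) C hc G 0)
    (TConfig (ReturnLeft (answer l h n (G n))) T (with_query_head H n) C hc G n).
Proof.
have -> : ord0 = inord (minn 0 l) :> 'I_l.+1.
  by apply: val_inj; rewrite /= min0n inordK.
by have := @scan_from T H C hc G n 0; rewrite addn0.
Qed.

(** Only the mark tells where the query head stood; there the mark is erased, and the whole query is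
    charged one clock cell. *)
Lemma return_right_from r T H C hc G p d q : d + q = p ->
  (forall q, q <= p -> is_marked (G q) = (q == p)) ->
  reach d.+1 (TConfig (ReturnRight r) T (with_query_head H q) C hc G q)
    (TConfig (Sim (answer_state M r)) T (with_query_head H p) C hc.+1
       (update G p (set_mark false (G p))) p).
Proof.
move=> + mG; elim: d q => [|d IH] q e.
  rewrite add0n in e; rewrite {q}e; apply: reach1.
  rewrite sstepE //= mG // eqxx /= !update_id; congr TConfig.
  by apply: functional_extensionality => i; rewrite update_id.
apply: reachS (IH q.+1 _); last by lia.
rewrite (@sstep_go_query _ (ReturnRight r) MRight) //= mG; last lia.
by case: eqP => //; lia.
Qed.

(** No head is to the right of the clock head, and a head at the left end stays there. So all heads
    are home when the clock head is. *)
Lemma rewind b T H C hc G hg : (forall q, q <= hc -> leftmost (C q) = (q == 0)) ->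
  (forall i, H i <= hc) -> hg <= hc ->
  reach hc.+1 (TConfig (Rewind b) T H C hc G hg)
    (TConfig (if b then Sweep true else Sim (tm_start M)) T (fun _ => 0) C 0 G 0).
Proof.
elim: hc H hg => [|hc IH] H hg lC leH leg.
  have -> : H = fun _ => 0.
    by apply: functional_extensionality => i; have := leH i; rewrite leqn0 => /eqP.
  by case: hg leg => // _; apply: reach1; apply: sstep_go => //=; rewrite lC.
apply: (@reachS _ _ (TConfig (Rewind b) T (fun i => (H i).-1) C hc G hg.-1)).
  rewrite sstepE //= lC //= !update_id; congr TConfig.
  by apply: functional_extensionality => i; rewrite update_id.
apply: IH => [q lq|i|]; [exact/lC/leqW| |lia].
by have := leH i; lia.
Qed.

End Phases.

(** * Correctness and running time of the search *)

(** A unary clock: it pays for [i] simulated steps, and the blank after it ends the attempt. *)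
Definition clock_track (i p : nat) : option Aux :=
  if p < i then Some (p == 0, false, false, false) else None.

(** A query answered in attempt [i] is shorter than [i], so [i] cells suffice. *)
Definition guess_track (i p : nat) : option Aux :=
  if p < i then Some (p == 0, pow2 p.+1, guess i p, false) else None.

Lemma clock_trackE i p : p < i -> clock_track i p = Some (p == 0, false, false, false).
Proof. by rewrite /clock_track => ->. Qed.

Lemma clock_track_end i : clock_track i i = None.
Proof. by rewrite /clock_track ltnn. Qed.

Lemma leftmost_clock i p : p < i -> leftmost (clock_track i p) = (p == 0).
Proof. by rewrite /clock_track => ->. Qed.

Section SearchRuns.
Variables (M : OTM) (l : nat) (h : nat -> bool) (x : seq bool).
Let k := tm_k M.
Let m := tm_m M.
Let st := state M l.
Notation reach := (@reach M l h).
Notation sstep := (@sstep M l h).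

Definition original (j : 'I_k.+2) (p : nat) : option bool :=
  if j == ord0 then nth None (map Some x) p else None.

Definition sim_tapes (c : config M) (j : 'I_k.+2) (p : nat) : Cell m :=
  (original j p, nth None (c_tapes c j) p).

(** Between simulated steps, the clock head counts the steps done and the guess head stands at the
    position of the query head. *)
Definition sim_config (i : nat) (c : config M) (s : nat) : tconfig k m st :=
  TConfig (Sim (c_state c)) (sim_tapes c) (c_heads c) (clock_track i) s
    (guess_track i) (c_heads c ord_max).

Definition oracle (i : nat) : pred (seq bool) := fun w =>
  if size w < l then h (size w) else guess i (size w).

Lemma sim_tapes_init : sim_tapes (init M x) = fun j p => input_cell m (original j p).
Proof.
apply: functional_extensionality => j; apply: functional_extensionality => p.
rewrite /sim_tapes /input_cell /original /=; case: eqP => [_|_]; last by rewrite nth_nil.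
by congr pair; elim: x p => [|b y IH] [|p] //=.
Qed.

Lemma sim_delta_step i c s : ~~ halted c -> ~~ is_query (c_state c) -> s < i ->
  sstep (sim_config i c s) = sim_config i (delta_step c) s.+1.
Proof.
rewrite /halted negb_or => /andP[/negbTE na /negbTE nr] /negbTE nq lt.
have ck := clock_trackE lt.
rewrite /sim_config sstepE //= na nr ck nq.
have -> : (fun j => (sim_tapes c j (c_heads c j)).2) =
  (fun j => nth None (c_tapes c j) (c_heads c j)) by [].
rewrite /sim_tapes /delta_step; case: (tm_delta _ _) => [[q w] mv] /=.
rewrite update_id (update_eq ck); congr TConfig.
apply: functional_extensionality => j; apply: functional_extensionality => p.
by rewrite /update nth_set_nth /=; case: eqP => // ->.
Qed.

(** Query head and query length are at most [s < i], so the four passes stay on the guess track and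
    take at most [s.+1] steps each. The return mark leaves the digits as they are. *)
Lemma sim_query i c s : ~~ halted c -> is_query (c_state c) -> s < i ->
  c_heads c ord_max <= s -> size (bits_prefix (c_tapes c ord_max)) <= s ->
  reach (4 * i + 8) (sim_config i c s) (sim_config i
    (Config (answer_state M (oracle i (bits_prefix (c_tapes c ord_max))))
       (c_tapes c) (c_heads c)) s.+1).
Proof.
rewrite /halted negb_or => /andP[/negbTE na /negbTE nr] qq lt lh.
set n := size _ => ln.
pose hq := c_heads c ord_max.
pose G := update (guess_track i) hq (set_mark true (guess_track i hq)).
have lG q : q < i -> leftmost (G q) = (q == 0).
  by move=> lq; rewrite /G /update; case: eqP => [<-|_]; rewrite /guess_track lq.
have mG q : q < i -> is_marked (G q) = (q == hq).
  by move=> lq; rewrite /G /update; case: eqP => [<-|_]; rewrite /guess_track lq.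
have -> : oracle i (bits_prefix (c_tapes c ord_max)) = answer l h n (G n).
  rewrite /oracle /answer -/n; case: ifP => // _.
  have ni : n < i by lia.
  rewrite /G /update; case: eqP => [<-|_]; rewrite /guess_track ni /= /guess;
    by case: (pow2 _).
have e0 : sstep (sim_config i c s) =
    TConfig SeekLeft (sim_tapes c) (with_query_head (c_heads c) hq) (clock_track i) s G hq.
  have ck := clock_trackE lt.
  rewrite /sim_config sstepE //= na nr ck qq /= (update_eq ck).
  rewrite /hq with_query_head_id; congr TConfig.
  by apply: functional_extensionality => j; rewrite update_id.
have e1 := @seek_left M l h (sim_tapes c) (c_heads c) (clock_track i) s G hq
  (fun q lq => lG q (leq_ltn_trans lq (leq_ltn_trans lh lt))).
have e2 := @scan M l h (sim_tapes c) (c_heads c) (clock_track i) s G n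
  (fun p lp => is_bit_bits_prefix lp) (nonbit_bits_prefix _).
set r := answer _ _ _ _ in e2 *.
have e3 := @return_left M l h r (sim_tapes c) (c_heads c) (clock_track i) s G n
  (fun q lq => lG q (leq_ltn_trans lq (leq_ltn_trans ln lt))).
have e4 := @return_right_from M l h r (sim_tapes c) (c_heads c) (clock_track i) s G hq hq 0
  (addn0 _) (fun q lq => mG q (leq_ltn_trans lq (leq_ltn_trans lh lt))).
have eG : update G hq (set_mark false (G hq)) = guess_track i.
  rewrite /G update_at update_update -[RHS](update_id _ hq); congr update.
  by rewrite /guess_track; case: ifP.
rewrite eG with_query_head_id in e4.
apply: reach_weaken (reachS e0 (reach_trans e1 (reach_trans e2 (reach_trans e3 e4)))).
by rewrite -/hq in lh; lia.
Qed.

Lemma sim_step i c s : ~~ halted c -> s < i ->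
  c_heads c ord_max <= s -> size (bits_prefix (c_tapes c ord_max)) <= s ->
  reach (4 * i + 8) (sim_config i c s) (sim_config i (step (oracle i) c) s.+1).
Proof.
move=> nh lt lh ln; have del : ~~ is_query (c_state c) ->
    reach (4 * i + 8) (sim_config i c s) (sim_config i (delta_step c) s.+1).
  by move=> nq; apply: reach_weaken (reach1 (sim_delta_step nh nq lt)); lia.
have := sim_query nh _ lt lh ln.
rewrite /step (negbTE nh) /answer_state; move: del; rewrite /is_query.
by case: (tm_query M) => [[[qq qy] qn]|] del sq; [case: ifP => [/sq|/negbT/del]|apply: del].
Qed.

Lemma sim_run i s : s <= i -> (forall t, t < s -> ~~ halted (run M (oracle i) x t)) ->
  reach (s * (4 * i + 8)) (sim_config i (init M x) 0)
    (sim_config i (run M (oracle i) x s) s).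
Proof.
elim: s => [|s IH] ls nh; first exact: reach_refl.
have r1 := IH (ltnW ls) (fun t lt => nh t (leqW lt)).
rewrite mulSn addnC; apply: reach_trans r1 _; rewrite runS; apply: sim_step => //.
- exact: nh.
- exact: (run_bounds (oracle i) x s ord_max).1.
- exact: query_length.
Qed.

Lemma sim_halted i c s : halted c ->
  t_state (sstep (sim_config i c s)) = Final (c_state c == tm_acc M).
Proof.
rewrite /halted /sim_config sstepE //=; case: eqP => //= _ /eqP ->.
by rewrite eqxx.
Qed.

(** Loop invariant at [p]: cells before [p] hold the original input and the digits of [i.+1], later
    cells are unchanged, and the state stores the carry. At the end of the tracks one cell is
    appended to clock and guess. *)
Lemma sweep i (T : 'I_k.+2 -> nat -> Cell m) d p : d + p = i -> 0 < i ->
  reach d.+1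
    (TConfig (Sweep (carry i p)) (fun j q => if q < p then input_cell m (T j q).1 else T j q)
       (fun _ => p) (clock_track i) p
       (fun q => if q < p then guess_track i.+1 q else guess_track i q) p)
    (TConfig (Rewind false) (fun j q => if q < i then input_cell m (T j q).1 else T j q)
       (fun _ => i) (clock_track i.+1) i (guess_track i.+1) i).
Proof.
elim: d p => [|d IH] p e i0.
  rewrite add0n in e; rewrite {p}e; apply: reach1.
  rewrite sstepE //= clock_track_end /=; congr TConfig.
  - by apply: functional_extensionality => j; rewrite update_id.
  - apply: functional_extensionality => q; rewrite /update /clock_track ltnS (leq_eqVlt q i).
    by case: eqP => [->|] //=; rewrite ?leqnn; case: i i0.
  - apply: functional_extensionality => q; rewrite /update.
    case: eqP => [->|ne].
      by rewrite /guess_track ltnSn guess_end carry_end; case: i i0.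
    case: ltnP => // le; rewrite /guess_track.
    have -> : (q < i) = false by lia.
    by have -> : (q < i.+1) = false by lia.
have lt : p < i by lia.
apply: reachS (IH p.+1 _ i0); last by lia.
have ck := clock_trackE lt.
rewrite sstepE //= ck /= (update_eq ck); congr TConfig.
- rewrite ltnn {1}/guess_track lt /= carryS; case: (boolP (pow2 p.+1)) => [pp|_] /=.
    by rewrite /guess pp.
  by rewrite andbT.
- apply: functional_extensionality => j; apply: functional_extensionality => q.
  by rewrite /update /clean ltnS (leq_eqVlt q p); case: eqP => [->|] //=; rewrite ltnn.
- apply: functional_extensionality => q; rewrite /update ltnS (leq_eqVlt q p).
  case: eqP => [->|] //=; rewrite ltnn /guess_track lt leqW //=.
  congr (Some (_, _, _, _)); rewrite /guess; case: (boolP (pow2 p.+1)) => //= pp.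
  by rewrite odd_carry.
Qed.

(** At most [i] simulated steps of cost [4 * i + 8], then two rewinds and a sweep of [i.+1] steps
    each; the constant leaves room for the change of state in between. *)
Definition attempt_cost (i : nat) : nat := 4 * (i * i) + 11 * i + 5.

(** By [run_bounds], [i] steps write only to cells below [i], and these the sweep restores. So the
    next attempt starts on the initial tapes. *)
Lemma next_attempt i : 0 < i -> (forall s, s <= i -> ~~ halted (run M (oracle i) x s)) ->
  reach (attempt_cost i) (sim_config i (init M x) 0) (sim_config i.+1 (init M x) 0).
Proof.
move=> i0 nh; pose c := run M (oracle i) x i.
have r1 := sim_run (leqnn i) (fun t lt => nh t (ltnW lt)).
have bd (j : 'I_k.+2) := run_bounds (oracle i) x i j.
have r2 : sstep (sim_config i c i) =
    TConfig (Rewind true) (sim_tapes c) (c_heads c) (clock_track i) i (guess_track i)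
      (c_heads c ord_max).
  have := nh i (leqnn i); rewrite /halted negb_or -/c => /andP[/negbTE na /negbTE nr].
  by apply: sstep_go => //=; rewrite na nr /clock_track ltnn.
have lC i' q : 0 < i' -> q <= i' -> leftmost (clock_track i' q) = (q == 0).
  move=> p0; rewrite leq_eqVlt => /orP[/eqP ->|]; last exact: leftmost_clock.
  by rewrite /clock_track ltnn; case: i' p0.
have r3 := @rewind M l h true (sim_tapes c) (c_heads c) (clock_track i) i (guess_track i)
  (c_heads c ord_max) (fun q => lC i q i0) (fun j => (bd j).1) (bd ord_max).1.
have r4 := @sweep i (sim_tapes c) i 0 (addn0 i) i0.
have r5 := @rewind M l h false
  (fun j q => if q < i then input_cell m (sim_tapes c j q).1 else sim_tapes c j q)
  (fun _ => i) (clock_track i.+1) i (guess_track i.+1) i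
  (fun q lq => lC i.+1 q isT (leqW lq)) (fun=> leqnn i) (leqnn i).
have eT : (fun j q => if q < i then input_cell m (sim_tapes c j q).1 else sim_tapes c j q) =
    sim_tapes (init M x).
  rewrite sim_tapes_init.
  apply: functional_extensionality => j; apply: functional_extensionality => q.
  case: ltnP => // lq; rewrite /sim_tapes (bd j).2 //.
  by have := congr1 (fun T => T j q) sim_tapes_init.
rewrite eT in r4 r5.
apply: reach_weaken (reach_trans r1 (reachS r2 (reach_trans r3 (reach_trans r4 r5)))).
by rewrite /attempt_cost; nia.
Qed.

Lemma setup : sstep (@tinit k m st Setup x) = sim_config 1 (init M x) 0.
Proof.
rewrite /sim_config sim_tapes_init /tinit sstepE //=; congr TConfig.
- by apply: functional_extensionality => j; rewrite update_id.
- by apply: functional_extensionality => -[].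
- by apply: functional_extensionality => -[].
Qed.

Lemma attempt_cost_le i j : i <= j -> attempt_cost i <= attempt_cost j.
Proof. by rewrite /attempt_cost; nia. Qed.

Lemma halting_attempt i u : u <= i -> halted (run M (oracle i) x u) ->
  exists s c, [/\ halted (run M (oracle i) x s),
    reach (attempt_cost i) (sim_config i (init M x) 0) c &
    t_state c = Final (c_state (run M (oracle i) x s) == tm_acc M)].
Proof.
move=> lu hu; pose P s := halted (run M (oracle i) x s).
have exP : exists s, P s by exists u.
case: (ex_minnP exP) => s hs smin.
have ls : s <= i by apply: leq_trans (smin _ hu) lu.
have nh v : v < s -> ~~ halted (run M (oracle i) x v).
  by rewrite ltnNge; apply: contra; apply: smin.
exists s, (sstep (sim_config i (run M (oracle i) x s) s)); split=> //.
  apply: reach_weaken (reach_trans (sim_run ls nh) (reach1 erefl)).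
  by rewrite /attempt_cost; nia.
exact: sim_halted.
Qed.

(** Induction on the attempts left before one known to halt. An earlier attempt may halt first,
    under another guess; so the answer is that of some attempt [j], and only the cost is governed by
    [i + d]. *)
Lemma search_from i d t : 0 < i -> t <= i + d -> halted (run M (oracle (i + d)) x t) ->
  exists j s c, [/\ halted (run M (oracle j) x s),
    reach (d.+1 * attempt_cost (i + d)) (sim_config i (init M x) 0) c &
    t_state c = Final (c_state (run M (oracle j) x s) == tm_acc M)].
Proof.
elim: d i => [|d IH] i i0 lt ht.
  rewrite addn0 in lt ht *; have [s [c [hs r e]]] := halting_attempt lt ht.
  by exists i, s, c; rewrite mul1n.
case: (boolP (has (fun s => halted (run M (oracle i) x s)) (iota 0 i.+1))) => [|/hasPn no].
  case/hasP=> u; rewrite mem_iota add0n ltnS => lu hu.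
  have [s [c [hs r e]]] := halting_attempt lu hu.
  exists i, s, c; split=> //; apply: reach_weaken r.
  rewrite mulSn; apply: leq_trans (leq_addr _ _).
  by apply: attempt_cost_le; lia.
have nh s : s <= i -> ~~ halted (run M (oracle i) x s).
  by move=> ls; apply: no; rewrite mem_iota add0n ltnS.
rewrite -addSnnS in lt ht *.
have [j [s [c [hs r e]]]] := IH i.+1 isT lt ht.
exists j, s, c; split=> //; rewrite mulSn.
apply: reach_trans r; apply: reach_weaken (next_attempt i0 nh).
by apply: attempt_cost_le; lia.
Qed.

Lemma search_halts i t : 0 < i -> t <= i -> halted (run M (oracle i) x t) ->
  exists j s n, [/\ halted (run M (oracle j) x s), n <= (i * attempt_cost i).+1 &
    let c := run (search_machine M l h) no_oracle x n in
    halted c /\ (c_state c == tm_acc (search_machine M l h)) =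
      (c_state (run M (oracle j) x s) == tm_acc M)].
Proof.
move=> i0 lt ht; have ei : 1 + i.-1 = i by rewrite add1n prednK.
rewrite -ei in lt ht.
have [j [s [c [hs r e]]]] := @search_from 1 i.-1 t isT lt ht.
have [n ln en] := reachS setup r.
exists j, s, n; split=> //; first by rewrite prednK // ei in ln.
have ec : c_state (run (search_machine M l h) no_oracle x n) =
    Final (c_state (run M (oracle j) x s) == tm_acc M) :> st.
  by rewrite -e -en -tracks_run.
rewrite /halted ec /=; split; first by case: (_ == tm_acc M).
by case: (_ == tm_acc M).
Qed.

End SearchRuns.

(** * Low for speed via the search *)

Definition agree (l : nat) (a b : nat -> bool) : Prop := forall p, p < l -> a p = b p.

Lemma agree_trans l a b c : agree l a b -> agree l b c -> agree l a c.
Proof. by move=> ab bc p lp; rewrite ab // bc. Qed.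

Lemma agree_le l l' a b : l <= l' -> agree l' a b -> agree l a b.
Proof. by move=> le ab p lp; apply: ab; apply: leq_trans le. Qed.

Definition length_language (a : nat -> bool) : pred (seq bool) := fun w => a (size w).

(** By [agreeing_guess] a right attempt is among the first [4 * n.+1], none of which costs more than
    the last; the extra step is the setup. *)
Definition search_time (n : nat) : nat :=
  let i := 4 * n.+1 in (i * attempt_cost i).+1.

Lemma search_time_poly : exists p : {poly nat}, forall n, (p.[n])%R = search_time n.
Proof.
pose Y : {poly nat} := (4%:P * 'X + 4%:P)%R.
exists (Y * (4%:P * (Y * Y) + 11%:P * Y + 5%:P) + 1%:P)%R => n.
rewrite !(hornerD, hornerM, hornerC, hornerX) /search_time /attempt_cost.
rewrite -[X in X = _]/((4 * n + 4) * (4 * ((4 * n + 4) * (4 * n + 4)) + 11 * (4 * n + 4) + 5) + 1).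
by rewrite -mulnSr addn1.
Qed.

(** A guess that agrees with [a] up to the running time reproduces the run, which bounds the search.
    Whichever attempt answers first uses a sparse oracle agreeing with [a] below [l], so its answer
    is forced to be right. *)
Lemma search_low_for_speed (M : OTM) (L : pred (seq bool)) f a l :
  sparse a -> decides_within M (length_language a) L f ->
  (forall b x t, sparse b -> agree l a b -> halted (run M (length_language b) x t) ->
     (c_state (run M (length_language b) x t) == tm_acc M) = L x) ->
  exists (M' : OTM) (p : {poly nat}),
    oracle_free M' /\ decides_within M' no_oracle L (fun x => (p.[f x])%R).
Proof.
move=> sa dec forced; have [p ep] := search_time_poly.
exists (search_machine M l a), p; split=> // x.
have [t [lt [ht _]]] := dec x.
have [i [ti ib ga]] := agreeing_guess t sa.
have hti : halted (run M (oracle l a i) x t).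
  rewrite (@run_local _ _ (length_language a)) // => w /ltnW lw.
  by rewrite /oracle ga // if_same.
have [j [s [n [hs ln [hn an]]]]] := search_halts (leq_ltn_trans (leq0n t) ti) (ltnW ti) hti.
exists n; split; [|split=> //].
  rewrite ep; apply: leq_trans ln _; rewrite ltnS.
  have le : i <= 4 * (f x).+1 by lia.
  by apply: leq_mul => //; apply: attempt_cost_le.
rewrite an.
pose b p := if p < l then a p else guess j p.
have ob : oracle l a j = length_language b by [].
rewrite ob in hs *; apply: forced => //.
  by move=> q; rewrite /b; case: ifP => [_ /sa|_ /guess_sparse].
by move=> q; rewrite /b => ->.
Qed.

(** * Machine codes *)

Definition move_code (mv : move) : option bool :=
  match mv with MLeft => Some false | MStay => None | MRight => Some true end.
Definition move_decode (o : option bool) : move :=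
  match o with Some false => MLeft | None => MStay | Some true => MRight end.
Lemma move_codeK : cancel move_code move_decode.
Proof. by case. Qed.

(** An [OTM] has an arbitrary finite type of states; numbering the states and tabulating the
    transitions leaves countably many codes, which the generic construction can enumerate. *)
Definition table (d : nat * nat * nat) : finType :=
  let: (k, m, n) := d in
  ('I_n * 'I_n * 'I_n * option ('I_n * 'I_n * 'I_n) *
   {ffun 'I_n * {ffun 'I_k.+2 -> option (bool + 'I_m)} ->
     'I_n * {ffun 'I_k.+2 -> option (bool + 'I_m)} * {ffun 'I_k.+2 -> option bool}})%type.

Definition code : countType := {d : nat * nat * nat & table d}.

Definition machine (c : code) : OTM :=
  let: existT (k, m, n) (s, a, r, q, dl) := c in
  {| tm_k := k; tm_m := m; tm_Q := 'I_n; tm_start := s; tm_acc := a; tm_rej := r;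
     tm_query := q;
     tm_delta := fun q f =>
       let: (q', w, mv) := dl (q, [ffun i => f i]) in
       (q', fun i => w i, fun i => move_decode (mv i)) |}.

Definition encode (M : OTM) : code :=
  existT (fun d => table d : Type) (tm_k M, tm_m M, #|tm_Q M|)
    (enum_rank (tm_start M), enum_rank (tm_acc M), enum_rank (tm_rej M),
     omap (fun q => (enum_rank q.1.1, enum_rank q.1.2, enum_rank q.2)) (tm_query M),
     [ffun u : 'I_#|tm_Q M| * {ffun 'I_(tm_k M).+2 -> option (bool + 'I_(tm_m M))} =>
        let: (q', w, mv) := tm_delta (enum_val u.1) (fun i => u.2 i) in
        (enum_rank q', [ffun i => w i], [ffun i => move_code (mv i)])]).

Definition rename_states (M : OTM) (c : config M) : config (machine (encode M)) :=
  @Config (machine (encode M)) (enum_rank (c_state c)) (c_tapes c) (c_heads c).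

Lemma rename_delta_step M (c : config M) :
  rename_states (delta_step c) = delta_step (rename_states c).
Proof.
rewrite /delta_step /rename_states /= ffunE /= enum_rankK.
have -> : (fun i => [ffun i0 => nth None (c_tapes c i0) (c_heads c i0)] i) =
  (fun i => nth None (c_tapes c i) (c_heads c i)).
  by apply: functional_extensionality => i; rewrite ffunE.
case: (tm_delta _ _) => [[q w] mv] /=; congr Config.
  by apply: functional_extensionality => i; rewrite ffunE.
by apply: functional_extensionality => i; rewrite ffunE move_codeK.
Qed.

Lemma rename_halted M (c : config M) : halted (rename_states c) = halted c.
Proof. by rewrite /halted /= !(inj_eq enum_rank_inj). Qed.

Lemma rename_step M X (c : config M) : rename_states (step X c) = step X (rename_states c).
Proof.
rewrite /step rename_halted; case: ifP => // _.
rewrite -!rename_delta_step [tm_query (machine _)]/= [c_state (rename_states c)]/=.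
case: (tm_query M) => [[[qq qy] qn]|] //=; rewrite (inj_eq enum_rank_inj).
by case: ifP => // _; rewrite /rename_states /=; case: ifP.
Qed.

Lemma rename_run M X x t : rename_states (run M X x t) = run (machine (encode M)) X x t.
Proof. by elim: t => [|t IH] //; rewrite !runS rename_step IH. Qed.

Lemma machine_encode_halted M X x t :
  halted (run (machine (encode M)) X x t) = halted (run M X x t).
Proof. by rewrite -rename_run rename_halted. Qed.

Definition accepts M X x t : bool := c_state (run M X x t) == tm_acc M.

Lemma machine_encode_accepts M X x t :
  accepts (machine (encode M)) X x t = accepts M X x t.
Proof. by rewrite /accepts -rename_run /= (inj_eq enum_rank_inj). Qed.

(** * Generic sparse oracles *)

Section Generic.
Variables (I : countType) (Q : I -> (nat -> bool) -> Prop).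
Hypothesis Qopen : forall i a, Q i a -> exists l, forall b, agree l a b -> Q i b.

(** Forcing: the part of [a] below [l] forces [Q i] or its negation among sparse oracles. *)
Definition decided (i : I) (a : nat -> bool) (l : nat) : Prop :=
  (forall b, sparse b -> agree l a b -> Q i b) \/
  (forall b, sparse b -> agree l a b -> ~ Q i b).

(** [(a, l)] stands for the finite part of [a] below [l]; later values may still change. *)
Definition condition := ((nat -> bool) * nat)%type.

Definition extends (n : nat) (s s' : condition) : Prop :=
  [/\ sparse s'.1, agree s.2 s.1 s'.1, s.2 < s'.2 &
    forall i, pickle i = n -> decided i s'.1 s'.2].

(** If some sparse extension satisfies [Q i], openness lets a finite part of it force [Q i];
    otherwise the condition already forces the negation. *)
Lemma extension n s : sparse s.1 -> exists s', extends n s s'.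
Proof.
case: s => a l /= sa.
case e : (pickle_inv n : option I) => [i|]; last first.
  exists (a, l.+1); split=> // i ei.
  by move: e; rewrite -ei pickleK_inv.
have same j : pickle j = n -> j = i.
  by move=> ej; move: e; rewrite -ej pickleK_inv => -[].
case: (classic (exists2 b, sparse b /\ agree l a b & Q i b)) => [[b [sb ab] qb]|no].
  have [l' open_l'] := Qopen qb.
  exists (b, maxn l.+1 l'); split=> //=; first by rewrite leq_max ltnS leqnn.
  move=> j /same -> {j}; left=> c _ bc; apply: open_l'.
  by apply: agree_le bc; apply: leq_maxr.
exists (a, l.+1); split=> // j /same -> {j}; right=> b sb ab qb.
by apply: no; exists b => //; split=> //; apply: agree_le ab.
Qed.

Definition extend n s : condition := epsilon (inhabits s) (extends n s).

Fixpoint stage n : condition :=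
  if n is n'.+1 then extend n' (stage n') else (fun _ => false, 0).

Lemma stage_sparse n : sparse (stage n).1.
Proof.
elim: n => [|n IH] //=.
by have [] := epsilon_spec (inhabits (stage n)) _ (extension n IH).
Qed.

Lemma stageS n : extends n (stage n) (stage n.+1).
Proof. exact: epsilon_spec (extension n (@stage_sparse n)). Qed.

Lemma stage_len n : n <= (stage n).2.
Proof. by elim: n => // n IH; have [_ _ lt _] := stageS n; apply: leq_ltn_trans lt. Qed.

Lemma stage_agree n m : n <= m -> agree (stage n).2 (stage n).1 (stage m).1.
Proof.
move=> /subnKC <-; elim: (m - n) => [|d IH]; first by rewrite addn0.
have le : (stage n).2 <= (stage (n + d)).2.
  elim: d {IH} => [|d IH]; rewrite ?addn0 // addnS.
  by have [_ _ lt _] := stageS (n + d); apply: leq_trans IH (ltnW lt).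
rewrite addnS; have [_ ag _ _] := stageS (n + d).
by apply: agree_trans IH (agree_le le ag).
Qed.

(** Stage [p.+1] has length above [p], so the value at [p] is final there. *)
Definition generic : nat -> bool := fun p => (stage p.+1).1 p.

Lemma generic_agree n : agree (stage n).2 (stage n).1 generic.
Proof.
move=> p lp; rewrite /generic; case: (leqP n p.+1) => [le|/ltnW le].
  exact: stage_agree.
by rewrite (stage_agree le) // stage_len.
Qed.

Lemma generic_sparse : sparse generic.
Proof. by move=> p; apply: stage_sparse. Qed.

Lemma generic_decided i : exists l, decided i generic l.
Proof.
have [_ _ _ dec] := stageS (pickle i).
exists (stage (pickle i).+1).2.
by have ag := generic_agree (n := (pickle i).+1);
  case: (dec i erefl) => P; [left|right] => b sb gb; apply: P => //; apply: agree_trans gb.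
Qed.

End Generic.

(* An index [(None, N)] asks that [N] errs on the language itself, and an index
   [(Some M, N)] that [M] with the oracle halts on some input with an answer
   different from that of [N]. *)
Definition refutes (i : option code * code) (a : nat -> bool) : Prop :=
  let: (o, N) := i in
  exists x s, halted (run (machine N) no_oracle x s) /\
    if o is Some M then
      exists t, halted (run (machine M) (length_language a) x t) /\
        accepts (machine M) (length_language a) x t <> accepts (machine N) no_oracle x s
    else length_language a x <> accepts (machine N) no_oracle x s.

(** A run of [t] steps depends only on lengths below [t], and membership of [x] only on the length
    of [x]. *)
Lemma refutes_open i a : refutes i a -> exists l, forall b, agree l a b -> refutes i b.
Proof.
case: i => [[M|] N] [x [s [hs]]].
  move=> [t [ht ne]]; exists t => b ab; exists x, s; split=> //; exists t.
  by rewrite /accepts -(@run_local _ (length_language a)) // => w /ab.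
move=> ne; exists (size x).+1 => b ab; exists x, s; split=> //.
by rewrite /length_language -ab.
Qed.

(** * Non-computability and lowness for speed of the generic set *)

Definition generic_set : nat -> bool := generic refutes.

(** For a decider [N], a forced refutation would apply to the generic set itself, where [N] is
    right; a forced negation fails once one free value of the oracle is flipped. *)
Lemma generic_set_not_computable : ~ computable (length_language generic_set).
Proof.
move=> [N [f [_ dec]]].
have acc x s : halted (run N no_oracle x s) ->
  accepts N no_oracle x s = generic_set (size x) by exact: decides_within_halted dec.
have [l [ref|nref]] := generic_decided refutes_open (None, encode N).
  have [x [s []]] := ref _ (generic_sparse refutes_open) (fun _ _ => erefl).
  by rewrite machine_encode_halted machine_encode_accepts => /acc ->.
(* A position outside the forced part where a sparse oracle may take either value. *)
pose p := (2 ^ l).-1.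
have lp : l <= p by rewrite -ltnS /p prednK ?expn_gt0 // ltn_expl.
pose b := update generic_set p (~~ generic_set p).
have sb : sparse b.
  move=> q; rewrite /b /update; case: eqP => [-> _|_]; last exact: (generic_sparse refutes_open).
  by rewrite /p prednK ?expn_gt0 // pow2_exp.
apply: (nref b sb) => [q lq|].
  by rewrite /b /update; case: eqP => // e; move: lq; rewrite e ltnNge lp.
have [s [_ [hs _]]] := dec (nseq p false).
exists (nseq p false), s; rewrite machine_encode_halted machine_encode_accepts acc //.
by split=> //; rewrite /length_language size_nseq /b update_at; case: (generic_set p).
Qed.

(** A forced refutation would make [M] and [N] disagree under the generic set, though both decide
    [L]. So the negation is forced: under every sparse oracle with the same finite part, [M] gives
    only right answers when it halts, as the search requires. *)
Lemma generic_set_low_for_speed : low_for_speed (length_language generic_set).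
Proof.
move=> L [N [g [_ decN]]] M f decM.
have accN x s : halted (run N no_oracle x s) -> accepts N no_oracle x s = L x.
  exact: decides_within_halted decN.
have accM x t : halted (run M (length_language generic_set) x t) ->
  accepts M (length_language generic_set) x t = L x.
  exact: decides_within_halted decM.
have [l [ref|nref]] := generic_decided refutes_open (Some (encode M), encode N).
  have [x [s [hs [t []]]]] := ref _ (generic_sparse refutes_open) (fun _ _ => erefl).
  rewrite !machine_encode_halted !machine_encode_accepts in hs *.
  by move=> ht; rewrite accN // accM.
apply: (search_low_for_speed (generic_sparse refutes_open) decM (l := l)) => b x t sb ab ht.
have [s [_ [hs _]]] := decN x.
case: (classic ((c_state (run M (length_language b) x t) == tm_acc M) = L x)) => // ne.
case: (nref b sb ab); exists x, s; rewrite machine_encode_halted; split=> //; exists t.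
by rewrite machine_encode_halted !machine_encode_accepts accN.
Qed.

Theorem theorem2p1 :
  exists X : pred (seq bool), ~ computable X /\ low_for_speed X.
Proof.
exists (length_language generic_set).
by split; [apply: generic_set_not_computable | apply: generic_set_low_for_speed].
Qed.
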